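(* Let $\{P_j\}_{j\in\mathbb{N}_0}$ be a sequence of orthogonal projections in a Hilbert space $\mathscr{H}$. Suppose there exists $0<c<1$ such that $$\|P_j(1-P_{j-1})y\|^2\geq c\,\|(1-P_{j-1})y\|^2$$ for all $y\in\mathscr{H}$ and all $j\in\mathbb{N}$. Then the system $\{P_j\}_{j\in\mathbb{N}_0}$ is effective.
   Context: $\mathbb{N}_0=\{0,1,2,\dots\}$, $\mathbb{N}=\{1,2,\dots\}$, and $1$ denotes the identity operator on $\mathscr{H}$. A system $\{P_j\}_{j\in\mathbb{N}_0}$ of orthogonal projections in $\mathscr{H}$ is called effective if $T_n:=(1-P_n)(1-P_{n-1})\cdots(1-P_0)$ converges to $0$ in the strong operator topology as $n\to\infty$, i.e. $T_nx\to 0$ in norm for every $x\in\mathscr{H}$. *)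

(* Defs.v *)
From HB Require Import structures.
From mathcomp Require Import all_boot all_order all_algebra.
From mathcomp Require Import all_classical all_reals all_analysis.
From mathcomp Require Import complex.

Set Implicit Arguments.
Unset Strict Implicit.
Unset Printing Implicit Defensive.

Import Order.TTheory GRing.Theory Num.Theory numFieldNormedType.Exports.

Local Open Scope classical_set_scope.
Local Open Scope ring_scope.

(* A Hilbert space is a complete normed module H over K, together with a
   definite Hermitian form dot : {dot H for theta} inducing its norm, where
   (K, theta) is either (R, id) or (C, complex conjugation).  As everywhere in
   MathComp, the norm takes its values in K; for K = R[i], `0 <= x` entails
   that x is real. *)
Variant hilbert_scalars (R : realType) :
    forall K : numFieldType, (K -> K) -> Prop :=
  | RealScalars : @hilbert_scalars R R idfun
  | ComplexScalars : @hilbert_scalars R R[i] Num.conj.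

Section Hilbert.
Context {K : numFieldType} {theta : K -> K} {H : completeNormedModType K}.
Variable dot : {dot H for theta}.

Definition norm_induced_by := forall x : H, `|x| ^+ 2 = dot x x.

Definition orthogonal_projection (P : {linear H -> H}) :=
  [/\ continuous P,
      forall x, P (P x) = P x
    & forall x y, dot (P x) y = dot x (P y)].

End Hilbert.

Section Effective.
Context {K : numFieldType} {H : completeNormedModType K}.
Variable P : nat -> {linear H -> H}.

Fixpoint residual (n : nat) : H -> H :=
  if n is m.+1 then (idfun \- P n) \o residual m else idfun \- P 0.

Definition effective := forall x : H, residual n x @[n --> \oo] --> (0 : H).

End Effective.

(* Main.v *)
Require Import Defs.
From mathcomp Require Import all_boot all_order all_algebra.
From mathcomp Require Import all_classical all_reals all_analysis.
From mathcomp Require Import complex.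
From mathcomp Require Import ring.

Import Order.TTheory GRing.Theory Num.Theory numFieldNormedType.Exports.

Local Open Scope classical_set_scope.
Local Open Scope ring_scope.

(** Each factor [1 - P n] removes a fixed proportion of what is left.  By
    Pythagoras ([pythagoras_projection]), the squared norm of [T_(n+1) x] is
    that of [T_n x] minus that of [P_(n+1) (T_n x)].  Since [T_n x] lies in the
    range of [1 - P_n], the hypothesis applied with [j = n + 1] says that the
    subtracted term is at least [c] times the squared norm of [T_n x].  So the
    squared norms shrink at each step by a factor of at most [1 - c].

    A geometric bound is more than is needed.  The weaker decay in [1 / n] of
    [contraction_harmonic_bound] already gives convergence, and it reduces the
    matter to the Archimedean property, which holds in the same form over the
    real and over the complex scalars ([hilbert_scalars_archimedean]). *)

(** Over the complex numbers [0 <= x] forces [x] to be real, so the Archimedean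
    property of the reals applies to its real part. *)
Lemma hilbert_scalars_archimedean {R : realType} {K : numFieldType}
    {theta : K -> K} :
  hilbert_scalars R theta -> forall x : K, 0 <= x -> exists n : nat, x < n%:R.
Proof.
case=> x x0; first by exists (Num.bound x); apply: archi_boundP.
move: x0; rewrite lecE => /andP[/eqP Imx0 Rex0].
exists (Num.bound (complex.Re x)).
have -> : x = (complex.Re x)%:C%C by case: x Imx0 {Rex0} => a b /= ->.
by rewrite -(rmorph_nat (real_complex R)) ltcR archi_boundP.
Qed.

(** Bernoulli's inequality in disguise: each step relies on
    [(1 + (n + 1) c) (1 - c) <= 1 + n c].  This form avoids powers and
    inverses. *)
Lemma contraction_harmonic_bound {K : numDomainType} {c : K} {a : nat -> K} :
  0 <= c -> (forall n, 0 <= a n) -> (forall n, a n.+1 <= (1 - c) * a n) ->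
  forall n, (1 + n%:R * c) * a n <= a 0.
Proof.
move=> c0 a0 aS; elim=> [|n IHn]; first by rewrite mul0r addr0 mul1r.
apply: le_trans IHn; apply: (@le_trans _ _ ((1 + n.+1%:R * c) * ((1 - c) * a n))).
  by rewrite ler_wpM2l ?aS // addr_ge0 // mulr_ge0.
rewrite mulrA ler_wpM2r // -subr_ge0.
have -> : 1 + n%:R * c - (1 + n.+1%:R * c) * (1 - c) = n.+1%:R * c ^+ 2.
  by rewrite -natr1; ring.
by rewrite mulr_ge0 // exprn_ge0.
Qed.

Lemma pythagoras_projection {K : numFieldType} {theta : K -> K}
    {H : completeNormedModType K} {dot : {dot H for theta}}
    {P : {linear H -> H}} (x : H) :
  norm_induced_by dot -> orthogonal_projection dot P ->
  `|x - P x| ^+ 2 = `|x| ^+ 2 - `|P x| ^+ 2.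
Proof.
move=> dotH [_ PP Psym].
have dotPx : dot x (P x) = dot (P x) (P x) by rewrite Psym PP.
by rewrite !dotH linearBl !linearBr /= [dot (P x) x]Psym dotPx subrr subr0.
Qed.

(** The residual [T_n x] is itself of the form [(1 - P_n) y]; this is what
    makes the hypothesis on consecutive projections applicable to it. *)
Lemma residual_in_range {K : numFieldType} {H : completeNormedModType K}
    (P : nat -> {linear H -> H}) (n : nat) (x : H) :
  exists y, residual P n x = (idfun \- P n) y.
Proof. by case: n => [|n]; [exists x | exists (residual P n x)]. Qed.

Theorem proposition7p4 (R : realType) (K : numFieldType) (theta : K -> K)
    (scalK : hilbert_scalars R theta)
    (H : completeNormedModType K) (dot : {dot H for theta})
    (dotH : norm_induced_by dot)
    (P : nat -> {linear H -> H})
    (projP : forall j, orthogonal_projection dot (P j))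
    (lowerP : exists c : K, 0 < c < 1 /\
       forall (y : H) (j : nat), (0 < j)%N ->
         `|P j ((idfun \- P j.-1) y)| ^+ 2 >=
           c * `|(idfun \- P j.-1) y| ^+ 2) :
  effective P.
Proof.
case: lowerP => c [/andP[c0 _] lowerP] x.
pose a n := `|residual P n x| ^+ 2.
have a_ge0 n : 0 <= a n by rewrite exprn_ge0.
have aS n : a n.+1 <= (1 - c) * a n.
  rewrite /a /= (pythagoras_projection _ dotH (projP n.+1)) mulrBl mul1r.
  rewrite lerD2l lerN2.
  by have [y ->] := residual_in_range P n x; apply: (lowerP y n.+1).
have a_bound := contraction_harmonic_bound (ltW c0) a_ge0 aS.
apply/cvgrPdist_lt => eps eps0.
have ceps0 : 0 < c * eps ^+ 2 by rewrite mulr_gt0 // exprn_gt0.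
have [N] : exists N : nat, a 0%N / (c * eps ^+ 2) < N%:R.
  by apply: (hilbert_scalars_archimedean scalK); rewrite divr_ge0 // ltW.
rewrite ltr_pdivrMr // => aN.
exists N => // n /= Nn; rewrite sub0r normrN.
rewrite real_ltNge ?normr_real ?gtr0_real //; apply/negP => eps_le.
have : a 0%N < a 0%N; last by rewrite ltxx.
apply: (lt_le_trans aN); apply: le_trans (a_bound n).
(* The summand [1] of the bound is dropped, which leaves [n * c * a n]. *)
rewrite mulrA mulrDl mul1r ler_wpDl // ler_pM //.
- by rewrite mulr_ge0 // ltW.
- by rewrite exprn_ge0 // ltW.
- by rewrite ler_pM2r // ler_nat.
- by rewrite lerXn2r ?nnegrE // ltW.
Qed.
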